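(* Let $A$ be an $n\times n$ nonnegative matrix. Then $0\neq\operatorname{per}(A)=\lvert\det(A)\rvert$ if and only if there exists $\tau\in S_n$ such that the following statements hold: (1) $L_\tau(A)\neq 0$; (2) for all distinct $i,j\in[n]$, $(AP_\tau)_{ij}=0$ or $(AP_\tau)_{ji}=0$; (3) the digraph $G(AP_\tau)$ contains no cycle of even length. In particular, if $A$ satisfies (1)-(3) with $\tau\in S_n$, then $\operatorname{per}(A)=\operatorname{sgn}(\tau)\det(A)$.
   Context: $[n]=\{1,\dots,n\}$. A nonnegative matrix is a matrix whose entries are all nonnegative real numbers; $A_{ij}$ is its $(i,j)$-entry. $\operatorname{per}(A)=\sum_{\sigma\in S_n}\prod_{i=1}^n A_{i\sigma(i)}$ is the permanent, and $L_\sigma(A)=\prod_{i=1}^n A_{i\sigma(i)}$ for $\sigma\in S_n$. For $\sigma\in S_n$, $P_\sigma$ is the $n\times n$ permutation matrix with $(P_\sigma)_{ij}=1$ if $i=\sigma(j)$ and $0$ otherwise; thus $(AP_\tau)_{ij}=A_{i\,\tau(j)}$. For an $n\times n$ matrix $M$, $G(M)$ is the digraph with vertex set $[n]$ and arc set $\{ij \mid M_{ij}\neq 0,\ i\neq j\}$ (the arc $ij$ goes from $i$ to $j$). A cycle of length $k$ in a digraph, where $k\ge 3$, is a directed closed walk $v_1v_2\cdots v_kv_1$ with $v_1,\dots,v_k$ distinct, where $v_iv_{i+1}$ ($1\le i\le k-1$) and $v_kv_1$ are arcs. *)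

(* Defs.v *)
From HB Require Import structures.
From mathcomp Require Import all_boot all_order all_algebra all_fingroup.
From mathcomp Require Import reals.

Set Implicit Arguments.
Unset Strict Implicit.
Unset Printing Implicit Defensive.

Import Order.TTheory GRing.Theory Num.Theory.

Local Open Scope ring_scope.

Definition diag_prod (R : comNzRingType) (n : nat) (s : 'S_n) (A : 'M[R]_n) : R :=
  \prod_(i < n) A i (s i).

Definition permanent (R : comNzRingType) (n : nat) (A : 'M[R]_n) : R :=
  \sum_(s : 'S_n) diag_prod s A.

(* The library's perm_mx uses the transposed convention: its (i, j) entry is 1
   iff s i = j. See perm_matrixE below. *)
Definition perm_matrix (R : comNzRingType) (n : nat) (s : 'S_n) : 'M[R]_n :=
  \matrix_(i < n, j < n) (i == s j)%:R.

Lemma perm_matrixE (R : comNzRingType) (n : nat) (s : 'S_n) :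
  perm_matrix R s = perm_mx s^-1%g.
Proof.
apply/matrixP => i j; rewrite !mxE; congr (nat_of_bool _)%:R.
by apply/eqP/eqP => [->|<-]; rewrite ?permK ?permKV.
Qed.

Lemma mulmx_perm_matrix (R : comNzRingType) (n : nat) (A : 'M[R]_n) (s : 'S_n)
    (i j : 'I_n) :
  (A *m perm_matrix R s) i j = A i (s j).
Proof. by rewrite perm_matrixE -col_permE mxE. Qed.

Definition mx_digraph (R : comNzRingType) (n : nat) (M : 'M[R]_n) : rel 'I_n :=
  fun i j => (M i j != 0) && (i != j).

(* A cycle v_1 v_2 ... v_k v_1 is represented by the sequence v_1, ..., v_k, so
   its length is the size of the sequence; 2-cycles are not cycles here. *)
Definition dicycle (T : eqType) (e : rel T) (c : seq T) : bool :=
  (3 <= size c)%N && ucycleb e c.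

Definition per_det_conditions (R : comNzRingType) (n : nat) (A : 'M[R]_n)
    (t : 'S_n) : Prop :=
  let B := A *m perm_matrix R t in
  [/\ diag_prod t A != 0,
      forall i j : 'I_n, i != j -> B i j = 0 \/ B j i = 0
    & ~ exists c : seq 'I_n, dicycle (mx_digraph B) c /\ ~~ odd (size c)].

(* Main.v *)
(* The nonzero terms of [per A] and [det A] are indexed by the same
   permutations, so for a nonnegative [A] the equality [0 <> per A = |det A|]
   means that there are such permutations and that all of them have the same
   sign.  Composing with one of them, [t], replaces [A] by a matrix [B] with
   nonzero diagonal, whose nonzero terms correspond to the disjoint unions of
   cycles of [G(B)].  A permutation is odd iff it has an odd number of cycles
   of even length, so all these permutations are even iff [G(B)] has no cycle
   of even length, 2-cycles included. *)
Require Import Defs.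
From HB Require Import structures.
From mathcomp Require Import all_boot all_order all_algebra all_fingroup.
From mathcomp Require Import reals.

Set Implicit Arguments.
Unset Strict Implicit.
Unset Printing Implicit Defensive.

Import Order.TTheory GRing.Theory Num.Theory.

Local Open Scope ring_scope.

Lemma porbit_fconnect (T : finType) (s : {perm T}) (x y : T) :
  (y \in porbit s x) = fconnect s x y.
Proof.
apply/porbitP/idP => [[i ->]|sxy]; first by rewrite permX fconnect_iter.
by exists (findex s x y); rewrite permX iter_findex.
Qed.

Lemma porbit_fixed (T : finType) (s : {perm T}) (x : T) :
  s x = x -> porbit s x = [set x].
Proof.
move=> sx; apply/setP => y; rewrite inE; apply/porbitP/eqP => [[i ->]|->].
  by rewrite permX; elim: i => //= i ->.
by exists 0%N; rewrite expg0 perm1.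
Qed.

(** By definition [odd_perm s] is the parity of [#|T|] plus the number of orbits. The orbits
    partition [T], so each orbit [P] contributes [#|P| + 1] to this sum, which is odd exactly when
    [#|P|] is even. *)
Lemma odd_perm_even_porbits (T : finType) (s : {perm T}) :
  odd_perm s = odd #|[set P in porbits s | ~~ odd #|P| ]|.
Proof.
have partP : partition (porbits s) [set: T].
  have -> : porbits s = orbit 'P%act <[s]>%g @: [set: T].
    rewrite /porbits porbitE.
    by apply/setP => P; apply/imsetP/imsetP => -[x _ ->]; exists x.
  by apply: orbit_partition; apply/actsP => a _ x; rewrite !inE.
rewrite /odd_perm -cardsT (card_partition partP) -!sum1_card.
rewrite !(big_morph odd oddD (erefl _)) -big_split /= [RHS]big_mkcond /=.
rewrite [LHS]big_mkcond /=; apply: eq_bigr => P _; rewrite inE addbT.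
by case: (P \in _); case: odd.
Qed.

(** The set of elements of [c] is one orbit and every other point is fixed, so there is exactly one
    orbit of even size. *)
Lemma odd_perm_next (T : finType) (c : seq T) (s : {perm T}) :
  uniq c -> s =1 next c -> c != [::] -> ~~ odd (size c) -> odd_perm s.
Proof.
move=> Uc sE c_neq0 even_c.
have s_cycle : fcycle s c by rewrite (eq_fcycle sE) cycle_next.
have orb_in x : x \in c -> porbit s x = [set y in c].
  move=> cx; apply/setP => y.
  by rewrite porbit_fconnect (fconnect_cycle s_cycle cx) inE.
have orb_out x : x \notin c -> porbit s x = [set x].
  by move=> cx; rewrite porbit_fixed // sE next_nth (negPf cx).
rewrite odd_perm_even_porbits.
suff -> : [set P in porbits s | ~~ odd #|P| ] = [set [set y in c]].
  by rewrite cards1.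
apply/setP => P; rewrite !inE; apply/andP/eqP => [[/imsetP[x _ ->]]|->].
  by case: (boolP (x \in c)) => [/orb_in //|/orb_out ->]; rewrite cards1.
split; last by rewrite cardsE (card_uniqP Uc).
case: c c_neq0 {Uc sE even_c s_cycle orb_out} orb_in => // x c _ orb_in.
by rewrite -(orb_in x) ?mem_head ?imset_f.
Qed.

(** An odd permutation has an orbit of even size, and running through it with [s] gives the cycle.
    Conversely, [next c] is a permutation that moves only points of [c], along arcs of [e]. *)
Lemma odd_perm_even_ucycle (T : finType) (e : rel T) :
  (exists2 s : {perm T}, odd_perm s & forall x, s x != x -> e x (s x)) <->
  (exists c : seq T, [/\ c != [::], ucycleb e c & ~~ odd (size c)]).
Proof.
split=> [[s odd_s s_e]|[c [c_neq0 /andP[c_e Uc] even_c]]].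
  have: [set P in porbits s | ~~ odd #|P| ] != set0.
    by apply: contraTneq odd_s; rewrite odd_perm_even_porbits => ->; rewrite cards0.
  case/set0Pn => P; rewrite inE => /andP[/imsetP[x _ ->{P}] even_x].
  have s_inj : injective s := @perm_inj _ s.
  have orbE : #|porbit s x| = size (fingraph.orbit s x).
    rewrite -(card_uniqP (orbit_uniq s x)); apply: eq_card => y.
    by rewrite porbit_fconnect fconnect_orbit.
  exists (fingraph.orbit s x); split; last by rewrite -orbE.
    by apply/eqP => x0; have := in_orbit s x; rewrite x0.
  rewrite /ucycleb orbit_uniq andbT.
  (* Every point of the orbit is moved by [s], since a fixed point would make the orbit a singleton,
     of odd size. *)
  apply: (@sub_in_cycle _ [pred y | s y != y] (frel s))
    (cycle_orbit s_inj x) => [y z sy _ /eqP<-|]; first exact: s_e.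
  apply/allP => y; rewrite -fconnect_orbit -porbit_fconnect.
  rewrite -eq_porbit_mem => /eqP orb_y /=; apply: contraNneq even_x => sy.
  by rewrite -orb_y porbit_fixed // cards1.
pose s := perm (can_inj (prev_next Uc)).
have sE : s =1 next c by move=> x; rewrite permE.
exists s => [|x]; first exact: odd_perm_next Uc sE c_neq0 even_c.
rewrite sE => nx; apply: next_cycle c_e _.
by apply: contraNT nx => /negPf cx; rewrite next_nth cx.
Qed.

Lemma diag_prodM (R : comNzRingType) (n : nat) (A : 'M[R]_n) (s t : 'S_n) :
  diag_prod (s * t)%g A = diag_prod s (A *m perm_matrix R t).
Proof. by apply: eq_bigr => i _; rewrite mulmx_perm_matrix permM. Qed.

Lemma diag_prod_neq0P (R : idomainType) (n : nat) (A : 'M[R]_n) (s : 'S_n) :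
  reflect (forall i, A i (s i) != 0) (diag_prod s A != 0).
Proof. by apply: (iffP (prodf_neq0 _ _)) => As i; auto. Qed.

(** A nonempty cycle of even length has length 2, which is a pair of opposite arcs, or at least 3,
    which is a [dicycle]. Thus conditions (2) and (3) merge into one. *)
Lemma even_ucycleP (T : eqType) (e : rel T) : irreflexive e ->
  (forall x y, ~~ (e x y && e y x)) /\
    ~ (exists c, dicycle e c /\ ~~ odd (size c)) <->
  ~ (exists c : seq T, [/\ c != [::], ucycleb e c & ~~ odd (size c)]).
Proof.
move=> e_irr; split=> [[e_asym e_even] [c [c_neq0 c_e even_c]]|e_even].
  case: c c_neq0 c_e even_c => [|x [|y [|z c]]] // _ c_e even_c.
    by have := e_asym x y; move: c_e; rewrite /ucycleb /= andbT => /andP[->].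
  by apply: e_even; exists [:: x, y, z & c].
split=> [x y|[c [/andP[c3 c_e] even_c]]]; last first.
  by apply: e_even; exists c; split=> //; apply: contraTneq c3 => ->.
apply/negP => /andP[xy yx]; apply: e_even; exists [:: x; y]; split=> //.
rewrite /ucycleb /= xy yx inE /= andbT.
by apply: contraTneq xy => ->; rewrite e_irr.
Qed.

Lemma per_det_conditions_odd (R : idomainType) (n : nat) (A : 'M[R]_n)
    (t : 'S_n) :
  per_det_conditions A t <->
  diag_prod t A != 0 /\
    (forall s : 'S_n, diag_prod s A != 0 -> odd_perm s = odd_perm t).
Proof.
rewrite /per_det_conditions; set B := A *m _; set e := mx_digraph B.
have e_irr : irreflexive e by move=> i; rewrite /e /mx_digraph eqxx andbF.
have asymP : (forall i j : 'I_n, i != j -> B i j = 0 \/ B j i = 0) <->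
    (forall i j, ~~ (e i j && e j i)).
  split=> [B0 i j|e_asym i j ij]; rewrite /e /mx_digraph.
    have [->|/B0[] ->] := eqVneq i j; by rewrite ?eqxx ?andbF.
  have := e_asym i j; rewrite /e /mx_digraph ij (eq_sym j) ij !andbT negb_and !negbK.
  by case/orP => /eqP; [left|right].
have oddP : diag_prod t A != 0 ->
    (forall s : 'S_n, diag_prod s A != 0 -> odd_perm s = odd_perm t) <->
    ~ (exists2 u : 'S_n, odd_perm u & forall i, u i != i -> e i (u i)).
  move=> /diag_prod_neq0P tA.
  (* The diagonal of [B] is nonzero, so only the points moved by [u] impose a condition. *)
  have uB (u : 'S_n) : diag_prod (u * t)%g A != 0 <->
      (forall i, u i != i -> e i (u i)).
    rewrite diag_prodM -/B; split=> [/diag_prod_neq0P uB i ui|ue].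
      by rewrite /e /mx_digraph uB eq_sym.
    apply/diag_prod_neq0P => i; have [->|/ue/andP[]//] := eqVneq (u i) i.
    by rewrite mulmx_perm_matrix.
  split=> [sA [u odd_u /uB/sA]|no_u s sA].
    by rewrite odd_permM odd_u; case: odd_perm.
  (* If the parities of [s] and [t] differ, this quotient is odd. *)
  apply/eqP/contraT => st; case: no_u; exists (s * t^-1)%g.
    by rewrite odd_permM odd_permV; move: st; do 2!case: odd_perm.
  by apply/uB; rewrite mulgKV.
have cycleP := iff_trans (even_ucycleP e_irr)
  (not_iff_compat (iff_sym (odd_perm_even_ucycle e))).
split=> [[tA /asymP B0 cB]|[tA /(oddP tA)/cycleP[/asymP B0 cB]]] //.
by split=> //; apply/(oddP tA)/cycleP.
Qed.

Section NonnegativeMatrix.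

Variables (R : realDomainType) (n : nat) (A : 'M[R]_n).
Hypothesis A_ge0 : forall i j, 0 <= A i j.

Lemma diag_prod_ge0 (s : 'S_n) : 0 <= diag_prod s A.
Proof. exact: prodr_ge0. Qed.

Lemma permanent_neq0P :
  reflect (exists s : 'S_n, diag_prod s A != 0) (permanent A != 0).
Proof.
rewrite psumr_eq0 => [|s _]; last exact: diag_prod_ge0.
by apply: (iffP allPn) => [[s _ sA]|[s sA]]; exists s; rewrite ?mem_index_enum.
Qed.

(** The difference of the two sides is a sum over [s] of terms that are 0 if [s] has parity [b] and
    twice [diag_prod s A] otherwise. All are nonnegative, so the sum vanishes only if each term
    does. *)
Lemma permanent_signed_detP (b : bool) :
  permanent A = (-1) ^+ b * \det A <->
  (forall s : 'S_n, diag_prod s A != 0 -> odd_perm s = b).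
Proof.
have detE : (-1) ^+ b * \det A =
    \sum_(s : 'S_n) (-1) ^+ (b (+) odd_perm s) * diag_prod s A.
  rewrite /determinant big_distrr /=; apply: eq_bigr => s _.
  by rewrite mulrA signr_addb.
rewrite detE; split=> [/eqP|sA]; last first.
  apply: eq_bigr => s _; have [->|/sA->] := eqVneq (diag_prod s A) 0.
    by rewrite mulr0.
  by rewrite addbb mul1r.
rewrite -subr_eq0 /permanent -sumrB psumr_eq0 => [/allP sum0 s sA|s _].
  have /= := sum0 s (mem_index_enum s).
  case: (odd_perm s) b {detE sum0} => -[] //=;
    rewrite mulN1r opprK -mulr2n mulrn_eq0 /=; by rewrite (negPf sA).
have := diag_prod_ge0 s; case: (_ (+) _) => sA /=.
  by rewrite mulN1r opprK addr_ge0.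
by rewrite mul1r subrr.
Qed.

End NonnegativeMatrix.

Theorem corollary3p2 (R : realType) (n : nat) (A : 'M[R]_n)
    (A_ge0 : forall i j : 'I_n, 0 <= A i j) :
  ((permanent A != 0 /\ permanent A = `|\det A|) <->
     (exists t : 'S_n, per_det_conditions A t)) /\
  (forall t : 'S_n,
     per_det_conditions A t -> permanent A = (-1) ^+ t * \det A).
Proof.
have perE t : per_det_conditions A t -> permanent A = (-1) ^+ t * \det A.
  by case/per_det_conditions_odd => _ /(permanent_signed_detP A_ge0).
split=> //; split=> [[per_neq0 per_det]|[t tA]]; last first.
  split; first by apply/(permanent_neq0P A_ge0); exists t; case: tA.
  have per_ge0 : 0 <= permanent A.
    by apply: sumr_ge0 => s _; apply: diag_prod_ge0.
  by rewrite -(ger0_norm per_ge0) (perE t tA) normrMsign.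
have /(permanent_neq0P A_ge0)[t tA] := per_neq0; exists t.
apply/per_det_conditions_odd; split=> //.
(* The common parity is read off from the sign of the determinant; any [t] with a nonzero term then
   has it too. *)
have sgn : permanent A = (-1) ^+ (\det A < 0)%R * \det A.
  by rewrite per_det normrEsign.
have sA := (permanent_signed_detP A_ge0 _).1 sgn.
by move=> s /sA ->; rewrite (sA t tA).
Qed.
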